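(* Let $q\in\widetilde{\mathbb C}$ and $\alpha,\beta\in\mathbb C$ with $\alpha+\beta\neq\frac{3-2q}{q-1}$, $\beta\neq\frac{1}{\sqrt q(\sqrt q+1)}-1$, and, for all $n\ge0$, $\alpha+\beta\neq-[n]_q-2$, $\beta\neq-[n]_q-1$ and $\alpha+\beta+2-(\beta+1)q^n+[n]_q\neq0$. Let $\mathcal G(\alpha,\beta,q)$ be the symmetrical form such that $\sigma\mathcal G(\alpha,\beta,q)=\mathbf J(\alpha,\beta,q)$. Then $\mathcal G(\alpha,\beta,q)$ is $H_{\sqrt q}$-semiclassical of class one and satisfies $$H_{\sqrt q}\big(x(x^2-1)\mathcal G(\alpha,\beta,q)\big)-(\sqrt q+1)\big((\alpha+\beta+2)x^2-(\beta+1)\big)\mathcal G(\alpha,\beta,q)=0 .$$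
   Context: $\mathcal P$ is the vector space of polynomials in one variable with complex coefficients and $\mathcal P'$ its dual; elements of $\mathcal P'$ are called forms; $\langle u,f\rangle$ is the action of $u$ on $f$ and $(u)_n=\langle u,x^n\rangle$ are the moments. All regular forms are normalized by $(u)_0=1$. A form is symmetrical if $(u)_{2n+1}=0$ for all $n\ge0$. Let $\widetilde{\mathbb C}=\{z\in\mathbb C: z\neq0,\ z^n\neq1\ \forall n\ge1\}$; $\sqrt{\cdot}$ is the principal square root; $[n]_q=\frac{q^n-1}{q-1}$. For a polynomial $g$, $\langle gu,f\rangle=\langle u,gf\rangle$. For $r\in\widetilde{\mathbb C}$, $(H_rf)(x)=\frac{f(rx)-f(x)}{(r-1)x}$ and $\langle H_ru,f\rangle=-\langle u,H_rf\rangle$. The form $\sigma u$ is defined by $\langle\sigma u,f\rangle=\langle u,f(x^2)\rangle$. A form $u$ is regular if there is a sequence of monic polynomials $\{B_n\}_{n\ge0}$, $\deg B_n=n$, with $\langle u,B_mB_n\rangle=r_n\delta_{n,m}$, $r_n\ne0$. A form $u$ is $H_r$-semiclassical if it is regular and $H_r(\Phi u)+\Psi u=0$ for some polynomials $\Phi$ (monic, degree $t\ge0$) and $\Psi$ (degree $p\ge1$). It is of class $s=\max(p-1,t-2)$ if the pair $(\Phi,\Psi)$ satisfies $$\prod_{c\in\mathcal Z_\Phi}\Big\{\big|r\Psi(rc)+(H_r\Phi)(c)\big|+\big|\langle u,\ r(\theta_{cr}\Psi)+\theta_{cr}(\theta_c\Phi)\rangle\big|\Big\}>0,$$ where $\mathcal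 Z_\Phi$ is the set of zeros of $\Phi$ and $(\theta_cf)(x)=\frac{f(x)-f(c)}{x-c}$. $\mathbf J(\alpha,\beta,q)$ (the $q$-analogue of the Jacobi form) is the form with $(\mathbf J(\alpha,\beta,q))_0=1$ satisfying $H_q\big(x(x-1)\mathbf J(\alpha,\beta,q)\big)-\big((\alpha+\beta+2)x-(\beta+1)\big)\mathbf J(\alpha,\beta,q)=0$. *)

(* Defs.v *)
From HB Require Import structures.
From mathcomp Require Import all_boot all_order all_algebra.
From mathcomp Require Import ring.
From mathcomp Require Import boolp classical_sets fsbigop reals.
From mathcomp.real_closed Require Import complex.

Set Implicit Arguments.
Unset Strict Implicit.
Unset Printing Implicit Defensive.

Import Order.TTheory GRing.Theory Num.Theory.

Local Open Scope ring_scope.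
Local Open Scope complex_scope.

Definition Ctilde (R : realType) (z : R[i]) : Prop :=
  z != 0 /\ forall n : nat, (1 <= n)%N -> z ^+ n != 1.

Definition qnum (R : realType) (q : R[i]) (n : nat) : R[i] :=
  (q ^+ n - 1) / (q - 1).

Definition form (R : realType) := {scalar {poly R[i]}}.

Definition moment (R : realType) (u : form R) (n : nat) : R[i] := u 'X^n.

Definition symmetrical (R : realType) (u : form R) : Prop :=
  forall n : nat, moment u n.*2.+1 = 0.

(* The polynomial quotients below are exact (for r != 1). *)
Definition Hpoly (R : realType) (r : R[i]) (f : {poly R[i]}) : {poly R[i]} :=
  (f \Po (r *: 'X) - f) %/ ((r - 1) *: 'X).

Definition theta (R : realType) (c : R[i]) (f : {poly R[i]}) : {poly R[i]} :=
  (f - f.[c]%:P) %/ ('X - c%:P).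

Definition mul_fun (R : realType) (g : {poly R[i]}) (u : form R) :
  {poly R[i]} -> R[i] := fun f => u (g * f).

Definition H_fun (R : realType) (r : R[i]) (u : form R) :
  {poly R[i]} -> R[i] := fun f => - u (Hpoly r f).

Definition sigma_fun (R : realType) (u : form R) :
  {poly R[i]} -> R[i] := fun f => u (f \Po 'X^2).

Lemma Hpoly_linear (R : realType) (r : R[i]) : linear (Hpoly r).
Proof.
move=> a f g; rewrite /Hpoly comp_polyD comp_polyZ.
rewrite (_ : _ - _ = a *: (f \Po (r *: 'X) - f) + (g \Po (r *: 'X) - g)).
  by rewrite divpD divpZl.
by rewrite scalerBr opprD addrACA.
Qed.

Lemma mul_fun_scalar (R : realType) (g : {poly R[i]}) (u : form R) :
  scalar (mul_fun g u).
Proof. by move=> a f h; rewrite /mul_fun mulrDr -scalerAr linearP. Qed.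

Lemma H_fun_scalar (R : realType) (r : R[i]) (u : form R) :
  scalar (H_fun r u).
Proof.
by move=> a f g; rewrite /H_fun Hpoly_linear linearP opprD mulrN.
Qed.

Lemma sigma_fun_scalar (R : realType) (u : form R) : scalar (sigma_fun u).
Proof. by move=> a f g; rewrite /sigma_fun comp_polyD comp_polyZ linearP. Qed.

HB.instance Definition _ (R : realType) (g : {poly R[i]}) (u : form R) :=
  GRing.isLinear.Build R[i] {poly R[i]} R[i] *%R (mul_fun g u)
    (mul_fun_scalar g u).

HB.instance Definition _ (R : realType) (r : R[i]) (u : form R) :=
  GRing.isLinear.Build R[i] {poly R[i]} R[i] *%R (H_fun r u)
    (H_fun_scalar r u).

HB.instance Definition _ (R : realType) (u : form R) :=
  GRing.isLinear.Build R[i] {poly R[i]} R[i] *%R (sigma_fun u)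
    (sigma_fun_scalar u).

Definition mulform (R : realType) (g : {poly R[i]}) (u : form R) : form R :=
  mul_fun g u.

Definition Hform (R : realType) (r : R[i]) (u : form R) : form R := H_fun r u.

Definition sigma (R : realType) (u : form R) : form R := sigma_fun u.

Definition regular (R : realType) (u : form R) : Prop :=
  exists (B : nat -> {poly R[i]}) (rho : nat -> R[i]),
    [/\ forall n, B n \is monic /\ size (B n) = n.+1,
        forall m n, u (B m * B n) = if m == n then rho n else 0
      & forall n, rho n != 0].

(* Regular forms are moreover normalized by (u)_0 = 1. *)
Definition semiclassical_pair (R : realType) (r : R[i]) (u : form R)
    (Phi Psi : {poly R[i]}) : Prop :=
  [/\ regular u /\ moment u 0 = 1, Phi \is monic, (1 <= (size Psi).-1)%N
    & Hform r (mulform Phi u) \+ mulform Psi u =1 \0].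

(* The product is over the (finite) set of zeros of Phi, without
   multiplicity; the norm on R[i] takes its values in R[i]. *)
Definition class_condition (R : realType) (r : R[i]) (u : form R)
    (Phi Psi : {poly R[i]}) : Prop :=
  0 < \big[*%R/1]_(c \in [set c : R[i] | root Phi c])
        (`| r * Psi.[r * c] + (Hpoly r Phi).[c] |
         + `| u (r *: theta (c * r) Psi + theta (c * r) (theta c Phi)) |).

(* deg f = (size f).-1.  Since deg Psi >= 1, the truncated subtractions give
   the integer max (deg Psi - 1) (deg Phi - 2). *)
Definition semiclassical_of_class (R : realType) (r : R[i]) (u : form R)
    (s : nat) : Prop :=
  exists Phi Psi : {poly R[i]},
    [/\ semiclassical_pair r u Phi Psi,
        s = maxn ((size Psi).-1 - 1) ((size Phi).-1 - 2)
      & class_condition r u Phi Psi].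

Definition is_qJacobi (R : realType) (al be q : R[i]) (u : form R) : Prop :=
  moment u 0 = 1 /\
  Hform q (mulform ('X * ('X - 1)) u)
    \- mulform ((al + be + 2) *: 'X - (be + 1)%:P) u =1 \0.

(* Definite description: the form satisfying P; it is the zero form when
   there is none. *)
Definition the_form (R : realType) (P : form R -> Prop) : form R :=
  xget (\0 : {classic form R}) P.

Definition qJacobi (R : realType) (al be q : R[i]) : form R :=
  the_form (is_qJacobi al be q).

Definition qJacobi_sym (R : realType) (al be q : R[i]) : form R :=
  the_form (fun u => symmetrical u /\ sigma u =1 qJacobi al be q).

Lemma formP (R : realType) (u v : form R) :
  (forall n, moment u n = moment v n) -> u =1 v.
Proof.
move=> uv f; rewrite -(coefK f) poly_def !linear_sum.
by apply: eq_bigr => i _; rewrite !linearZ; congr (_ * _); exact: uv.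
Qed.

Definition moments_fun (R : realType) (mu : nat -> R[i]) :
  {poly R[i]} -> R[i] := fun f => \sum_(i < size f) f`_i * mu i.

Lemma moments_fun_scalar (R : realType) (mu : nat -> R[i]) :
  scalar (moments_fun mu).
Proof.
have widen (f : {poly R[i]}) n : (size f <= n)%N ->
    moments_fun mu f = \sum_(i < n) f`_i * mu i.
  move=> sf; rewrite /moments_fun (big_ord_widen n (fun i => f`_i * mu i) sf).
  rewrite big_mkcond; apply: eq_bigr => i _; case: ltnP => // fi.
  by rewrite nth_default ?mul0r.
move=> a f g; pose n := maxn (size (a *: f + g)) (maxn (size f) (size g)).
rewrite (widen _ n) ?leq_maxl// (widen f n); last by rewrite /n !leq_max leqnn orbT.
rewrite (widen g n); last by rewrite /n !leq_max leqnn !orbT.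
rewrite mulr_sumr -big_split; apply: eq_bigr => i _.
by rewrite coefD coefZ mulrDl mulrA.
Qed.

HB.instance Definition _ (R : realType) (mu : nat -> R[i]) :=
  GRing.isLinear.Build R[i] {poly R[i]} R[i] *%R (moments_fun mu)
    (moments_fun_scalar mu).

Lemma moment_moments_fun (R : realType) (mu : nat -> R[i]) (n : nat) :
  moment (moments_fun mu : form R) n = mu n.
Proof.
rewrite /moment /= /moments_fun size_polyXn big_ord_recr /= big1 ?add0r => [|i _].
  by rewrite coefXn eqxx mul1r.
by rewrite coefXn ltn_eqF ?mul0r.
Qed.

Lemma HpolyXn (R : realType) (r : R[i]) (n : nat) : r != 1 ->
  Hpoly r 'X^n = qnum r n *: 'X^(n.-1).
Proof.
move=> r1; have r1' : r - 1 != 0 by rewrite subr_eq0.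
rewrite /Hpoly comp_Xn_poly exprZn -{2}['X^n]scale1r -scalerBl.
case: n => [|n]; first by rewrite /qnum expr0 subrr mul0r !scale0r div0p.
rewrite divpZl divpZr // (exprSr 'X) mulpK ?polyX_eq0 //.
by rewrite scalerA.
Qed.

Lemma is_qJacobiE (R : realType) (al be q : R[i]) (u : form R) : q != 1 ->
  is_qJacobi al be q u <->
  moment u 0 = 1 /\ forall n : nat,
    (al + be + 2 + qnum q n) * moment u n.+1
    = (be + 1 + qnum q n) * moment u n.
Proof.
move=> q1; pose D : form R :=
  Hform q (mulform ('X * ('X - 1)) u)
    \- mulform ((al + be + 2) *: 'X - (be + 1)%:P) u.
have momD n : moment D n = (be + 1 + qnum q n) * moment u n
                         - (al + be + 2 + qnum q n) * moment u n.+1.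
  have -> : moment D n = - u ('X * ('X - 1) * Hpoly q 'X^n)
                         - u (((al + be + 2) *: 'X - (be + 1)%:P) * 'X^n) by [].
  have -> : 'X * ('X - 1) * Hpoly q 'X^n = qnum q n *: ('X^(n.+1) - 'X^n).
    rewrite HpolyXn // -scalerAr; case: n => [|n] /=.
      by rewrite /qnum expr0 subrr mul0r !scale0r.
    by rewrite mulrAC -exprS mulrBr mulr1 -exprSr.
  have -> : ((al + be + 2) *: 'X - (be + 1)%:P) * 'X^n
            = (al + be + 2) *: 'X^(n.+1) - (be + 1) *: 'X^n.
    by rewrite mulrBl -scalerAl -exprS mul_polyC.
  have uZ a f : u (a *: f) = a * u f by rewrite linearZ.
  have uB f g : u (f - g) = u f - u g by rewrite linearB.
  by rewrite uZ !uB !uZ /moment; ring.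
split=> -[u0 uE]; split=> // n.
  by apply/eqP; rewrite eq_sym -subr_eq0 -momD /moment; apply/eqP; exact: uE.
have D0 : D =1 (\0 : form R).
  by apply: formP => k; rewrite momD uE subrr.
exact: D0.
Qed.

Lemma the_formP (R : realType) (P : form R -> Prop) :
  (exists u, P u) -> P (the_form P).
Proof. by move=> exP; rewrite /the_form; exact: xgetPex. Qed.

Lemma qJacobiP (R : realType) (al be q : R[i]) : q != 1 ->
    (forall n : nat, al + be != - qnum q n - 2) ->
  is_qJacobi al be q (qJacobi al be q) /\
  forall u, is_qJacobi al be q u -> u =1 qJacobi al be q.
Proof.
move=> q1 ab; have den n : al + be + 2 + qnum q n != 0.
  by rewrite -addrA addr_eq0 opprD [- 2 - _]addrC.
have JP : is_qJacobi al be q (qJacobi al be q).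
  apply: the_formP.
  exists (moments_fun (fun n => \prod_(k < n)
    ((be + 1 + qnum q k) / (al + be + 2 + qnum q k)))).
  apply/is_qJacobiE => //; rewrite moment_moments_fun big_ord0; split=> // n.
  by rewrite !moment_moments_fun big_ord_recr /= mulrC -mulrA divfK // mulrC.
split=> // u /(is_qJacobiE _ _ _ q1)[u0 uE].
have [J0 JE] := (is_qJacobiE al be (qJacobi al be q) q1).1 JP.
apply: formP; elim=> [|n IHn]; first by rewrite u0 J0.
by apply: (mulfI (den n)); rewrite uE JE IHn.
Qed.

Lemma qJacobi_symP (R : realType) (al be q : R[i]) :
  (symmetrical (qJacobi_sym al be q) /\
   sigma (qJacobi_sym al be q) =1 qJacobi al be q) /\
  forall u, symmetrical u -> sigma u =1 qJacobi al be q ->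
    u =1 qJacobi_sym al be q.
Proof.
have momS (u : form R) n : moment (sigma u) n = moment u n.*2.
  by rewrite /moment /sigma /= /sigma_fun comp_Xn_poly -exprM mul2n.
have GP : symmetrical (qJacobi_sym al be q) /\
          sigma (qJacobi_sym al be q) =1 qJacobi al be q.
  apply: (the_formP (P := fun u => symmetrical u /\ sigma u =1 _)).
  exists (moments_fun (fun n =>
    if odd n then 0 else moment (qJacobi al be q) n./2)); split=> [n|].
    by rewrite moment_moments_fun /= odd_double.
  by apply: formP => n; rewrite momS moment_moments_fun odd_double doubleK.
split=> // u usym uE; case: GP => Gsym GE; apply: formP => n.
rewrite -(odd_double_half n); case: (odd n); first by rewrite usym Gsym.
by rewrite add0n -!momS /moment uE GE.
Qed.

(* Main.v *)
Require Import Defs.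
From mathcomp Require Import all_boot all_order all_algebra.
From mathcomp Require Import ring.
From mathcomp Require Import classical_sets fsbigop reals.
From mathcomp.real_closed Require Import complex.

Set Implicit Arguments.
Unset Strict Implicit.
Unset Printing Implicit Defensive.

Import Order.TTheory GRing.Theory Num.Theory.
Import Defs.
Local Open Scope ring_scope.
Local Open Scope complex_scope.

(** A symmetrical form u splits into its even part sigma u, with moments m_n,
    and the form X (sigma u): u is regular as soon as both of these have
    orthogonal polynomials P_n and P*_n, because P_n(x^2) and x P*_n(x^2) are
    then orthogonal for u ([regular_of_even_odd]).  Here sigma u is the
    q-Jacobi form, whose equation says, after multiplication by q - 1,
      (q^n - a) m_(n+1) = (q^n - b) m_n
    with a = 1 - (q - 1)(al + be + 2) and b = 1 - (q - 1)(be + 1); the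
    hypotheses on al + be and be say that q^n differs from a, from b, and that
    a differs from b q^n.  The moments of X^i (sigma u) satisfy the same
    recurrence with q^(i+n) for q^n, so one family handles all the shifts.

    Its orthogonal polynomials are the little q-Jacobi polynomials.  They are
    generated, up to a nonzero factor, by a recurrence that relates the shifts
    i and i + 1 ([littleqJ]), and the pairing of the n-th one with X^k is the
    k-th moment times an explicit product that contains the factors q^k - q^j
    for all j < n ([littleqJ_moment]).  The product vanishes for k < n and,
    since q is not a root of unity, does not vanish for k = n.

    With r^2 = q, the equation for u is trivial on odd powers of x, where all
    moments vanish by symmetry, and on x^(2k) it is r + 1 times the recurrence
    above, because [2k]_r = (r + 1) [k]_q ([symmetrized_equation]).  The zeros
    of x (x^2 - 1) are 0, 1 and -1.  At 0 the class condition asks for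
    r (r + 1)(be + 1) to differ from 1; at 1 and -1 its two terms vanish
    together only if (al + be + 2) q = 1 and be + 1 = 0
    ([symmetrized_class]). *)

(** * Little q-Jacobi polynomials and their moments *)

(** Up to a nonzero factor, the orthogonal polynomials of the form X^i L, where
    (q^n - a) L(X^(n+1)) = (q^n - b) L(X^n).  The recurrence is a contiguous
    relation in which the shift i, not only the degree, varies; it involves no
    division, so that it makes sense for all values of a and b. *)
Fixpoint littleqJ (F : fieldType) (q a b : F) (n i : nat) : {poly F} :=
  if n is m.+1 then
    (a - q ^+ (i + m + m)) *: ('X * littleqJ q a b m i.+1)
    + (q ^+ m * (q ^+ (i + m) - b)) *: littleqJ q a b m i
  else 1.

(** The quotient L(X^(i+k) R) / L(X^(i+k)) for R = littleqJ q a b n i, as a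
    function of k; as a rational function of q^k it vanishes at 1, q, ...,
    q^(n-1). *)
Definition littleqJ_ratio (F : fieldType) (q a b : F) (n i k : nat) : F :=
  \prod_(j < n) (q ^+ (i + j) * (a - b * q ^+ j) * (q ^+ k - q ^+ j)
                 / (q ^+ (i + k + j) - a)).

Section LittleQJacobi.

Variables (F : fieldType) (q a b : F).
Hypotheses (q_neq0 : q != 0) (a_neqX : forall n, q ^+ n - a != 0).

Lemma size_littleqJ n i : size (littleqJ q a b n i) = n.+1.
Proof.
elim: n i => [|n IHn] i /=; first by rewrite size_poly1.
have c_neq0 : a - q ^+ (i + n + n) != 0 by rewrite -opprB oppr_eq0 a_neqX.
have size_lead : size ((a - q ^+ (i + n + n)) *: ('X * littleqJ q a b n i.+1))
                 = n.+2.
  by rewrite size_scale // mulrC size_mulX ?IHn // -size_poly_gt0 IHn.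
rewrite size_polyDl size_lead // ltnS.
by rewrite (leq_trans (size_scale_leq _ _)) ?IHn.
Qed.

(** The denominators of the products for i and i + 1 telescope. *)
Lemma littleqJ_ratio_shift n i k :
  littleqJ_ratio q a b n i.+1 k * (q ^+ (i + k + n) - a)
  = q ^+ n * littleqJ_ratio q a b n i k * (q ^+ (i + k) - a).
Proof.
elim: n => [|n IHn]; first by rewrite /littleqJ_ratio !big_ord0 addn0 mulr1.
have H i' : littleqJ_ratio q a b n.+1 i' k = littleqJ_ratio q a b n i' k
    * (q ^+ (i' + n) * (a - b * q ^+ n) * (q ^+ k - q ^+ n)
       / (q ^+ (i' + k + n) - a)).
  by rewrite /littleqJ_ratio big_ord_recr.
rewrite !{}H !addSn addnS.
have d1 := a_neqX (i + k + n); have d2 := a_neqX (i + k + n).+1.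
set D := q ^+ (i + k + n) - a in IHn d1 *.
set D' := q ^+ (i + k + n).+1 - a in d2 *.
set x := littleqJ_ratio q a b n i.+1 k in IHn *.
set y := littleqJ_ratio q a b n i k in IHn *.
set z := q ^+ (i + k) - a in IHn *.
set t := a - b * q ^+ n; set w := q ^+ k - q ^+ n; rewrite !exprS.
rewrite [RHS](_ : _ = q * q ^+ (i + n) * t * w / D * (q ^+ n * y * z)); last by ring.
by rewrite -IHn; field; rewrite d1 d2.
Qed.

Lemma littleqJ_ratio_diag_neq0 n i :
    (forall m, (0 < m)%N -> q ^+ m != 1) -> (forall m, a - b * q ^+ m != 0) ->
  littleqJ_ratio q a b n i n != 0.
Proof.
move=> q_nroot ab; apply/prodf_neq0 => j _.
rewrite !mulf_neq0 ?expf_neq0 ?invr_neq0 //.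
rewrite -[X in q ^+ X - _](subnKC (ltnW (ltn_ord j))) exprD.
rewrite -[X in _ - X]mulr1 -mulrBr mulf_neq0 ?expf_neq0 // subr_eq0.
by rewrite q_nroot // subn_gt0.
Qed.

Lemma littleqJ_ratio_eq0 n i k : (k < n)%N -> littleqJ_ratio q a b n i k = 0.
Proof.
move=> ltkn; rewrite /littleqJ_ratio (bigD1 (Ordinal ltkn)) //=.
by rewrite subrr mulr0 !mul0r.
Qed.

Variable L : {scalar {poly F}}.
Hypothesis L_rec : forall n,
  (q ^+ n - a) * L 'X^(n.+1) = (q ^+ n - b) * L 'X^n.

(** By induction on n along the recurrence that defines the polynomials: with
    c = q^i, w = q^n and z = q^k, the step is the polynomial identity
    w (a - c w^2)(c z - b) + w (c w - b)(c z w - a) = c w (a - b w)(z - w). *)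
Lemma littleqJ_moment n i k :
  L ('X^(i + k) * littleqJ q a b n i) = L 'X^(i + k) * littleqJ_ratio q a b n i k.
Proof.
elim: n i k => [|n IHn] i k; first by rewrite /littleqJ_ratio big_ord0 !mulr1.
rewrite /= mulrDr -!scalerAr mulrA -exprSr linearD !linearZ /= -addSn !IHn.
have d1 := a_neqX (i + k); have d2 := a_neqX (i + k + n).
have -> : L 'X^(i.+1 + k) = (q ^+ (i + k) - b) * L 'X^(i + k) / (q ^+ (i + k) - a).
  by apply: (mulfI d1); rewrite addSn L_rec; field.
have -> : littleqJ_ratio q a b n i.+1 k
   = q ^+ n * littleqJ_ratio q a b n i k * (q ^+ (i + k) - a)
     / (q ^+ (i + k + n) - a).
  by apply: (mulIf d2); rewrite littleqJ_ratio_shift divfK.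
rewrite [in RHS]/littleqJ_ratio big_ord_recr /= -/(littleqJ_ratio q a b n i k).
rewrite !exprD in d1 d2 *.
by field; rewrite d1 d2.
Qed.

End LittleQJacobi.

(** * Regularity of forms *)

Lemma form_mul_top (R : realType) (u : form R) (p B : {poly R[i]}) (n : nat) :
    (forall k, (k < n)%N -> u ('X^k * B) = 0) -> (size p <= n.+1)%N ->
  u (p * B) = p`_n * u ('X^n * B).
Proof.
move=> orth szp; rewrite -[p in LHS]coefK.
rewrite poly_def (big_ord_widen _ (fun i => p`_i *: 'X^i) szp) big_mkcond /=.
rewrite mulr_suml linear_sum /= big_ord_recr /= big1 ?add0r => [|i _].
  case: ltnP => [_|szn]; first by rewrite -scalerAl linearZ.
  by rewrite mul0r linear0 nth_default ?mul0r.
case: ifP => _; first by rewrite -scalerAl linearZ /= orth ?mulr0.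
by rewrite mul0r linear0.
Qed.

(** It suffices to test orthogonality against powers of x, and B n need not be
    monic: it is divided by its leading coefficient. *)
Lemma regular_of_orthogonal (R : realType) (u : form R)
    (B : nat -> {poly R[i]}) :
    (forall n, size (B n) = n.+1) ->
    (forall n k, (k < n)%N -> u ('X^k * B n) = 0) ->
    (forall n, u ('X^n * B n) != 0) ->
  regular u.
Proof.
move=> szB orth norm.
have lc_neq0 n : lead_coef (B n) != 0 by rewrite lead_coef_eq0 -size_poly_eq0 szB.
pose M n := (lead_coef (B n))^-1 *: B n.
have szM n : size (M n) = n.+1 by rewrite size_scale ?invr_eq0.
have monM n : M n \is monic by rewrite monicE lead_coefZ mulVf.
have orthM n k : (k < n)%N -> u ('X^k * M n) = 0.
  by move=> ltkn; rewrite -scalerAr linearZ /= orth ?mulr0.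
exists M, (fun n => u ('X^n * M n)); split=> [n||n]; first by split.
  have lt0 m n : (m < n)%N -> u (M m * M n) = 0.
    move=> ltmn; rewrite (form_mul_top (orthM n)) ?szM 1?ltnW //.
    by rewrite nth_default ?mul0r ?szM.
  move=> m n; case: ltngtP => [/lt0 //|/lt0|<-]; first by rewrite mulrC.
  rewrite (form_mul_top (orthM m)) ?szM //.
  by have := monM m; rewrite monicE lead_coefE szM => /eqP ->; rewrite mul1r.
by rewrite -scalerAr linearZ mulf_neq0 ?invr_eq0.
Qed.

Section Symmetrization.

Variables (R : realType) (u : form R).
Hypothesis u_sym : symmetrical u.

Lemma symmetrical_odd (k : nat) (f : {poly R[i]}) : odd k ->
  u ('X^k * (f \Po 'X^2)) = 0.
Proof.
move=> k_odd; rewrite comp_polyE mulr_sumr linear_sum big1 // => i _.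
rewrite -scalerAr linearZ /= -exprM -exprD -[k]odd_double_half k_odd mul2n.
by rewrite -addnA -doubleD add1n [u _](u_sym _) mulr0.
Qed.

Lemma symmetrical_even (k : nat) (f : {poly R[i]}) :
  u ('X^(k.*2) * (f \Po 'X^2)) = sigma u ('X^k * f).
Proof. by rewrite /sigma /= /sigma_fun comp_polyM comp_Xn_poly -exprM mul2n. Qed.

(** The orthogonal polynomials of u are P0 n (x^2) in degree 2n and
    x P1 n (x^2) in degree 2n + 1.  Products of opposite parity are killed by
    symmetry; the others are computed by sigma u, with one more factor X for
    odd degrees. *)
Lemma regular_of_even_odd (P0 P1 : nat -> {poly R[i]}) :
    (forall n, size (P0 n) = n.+1) -> (forall n, size (P1 n) = n.+1) ->
    (forall n k, (k < n)%N -> sigma u ('X^k * P0 n) = 0) ->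
    (forall n k, (k < n)%N -> sigma u ('X^(k.+1) * P1 n) = 0) ->
    (forall n, sigma u ('X^n * P0 n) != 0) ->
    (forall n, sigma u ('X^(n.+1) * P1 n) != 0) ->
  regular u.
Proof.
move=> sz0 sz1 orth0 orth1 norm0 norm1.
pose B n := if odd n then 'X * (P1 n./2 \Po 'X^2) else P0 n./2 \Po 'X^2.
have sz2 (f : {poly R[i]}) n : size f = n.+1 -> size (f \Po 'X^2) = n.*2.+1.
  move=> szf; rewrite polySpred ?size_comp_poly ?szf ?size_polyXn ?muln2 //.
  by rewrite comp_poly_eq0 ?size_polyXn // -size_poly_eq0 szf.
apply: (@regular_of_orthogonal _ _ B) => [n|n k|n]; rewrite /B.
- rewrite -[in RHS](odd_double_half n); case: (odd n); last exact: sz2.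
  by rewrite mulrC size_mulX -?size_poly_eq0 (sz2 _ n./2).
- rewrite -{1}(odd_double_half n) -{1 2}(odd_double_half k).
  have [n_odd|n_even] := boolP (odd n); have [k_odd|k_even] := boolP (odd k).
  + rewrite ltn_add2l ltn_double => lt_kn.
    by rewrite mulrA -exprSr add1n -doubleS symmetrical_even orth1.
  + by rewrite mulrA -exprSr symmetrical_odd //= ?oddS add0n odd_double.
  + by rewrite symmetrical_odd //= odd_double.
  + by rewrite !add0n ltn_double symmetrical_even; exact: orth0.
rewrite -[in X in 'X^X](odd_double_half n); case: (odd n).
  by rewrite mulrA -exprSr add1n -doubleS symmetrical_even.
by rewrite add0n symmetrical_even.
Qed.

End Symmetrization.

(** The shift 0 of the little q-Jacobi polynomials is orthogonal for sigma u,
    the shift 1 for X (sigma u). *)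
Lemma regular_of_qJacobi_moments (R : realType) (q a b : R[i]) (u : form R) :
    q != 0 -> (forall n, (0 < n)%N -> q ^+ n != 1) ->
    (forall n, q ^+ n - a != 0) -> (forall n, q ^+ n - b != 0) ->
    (forall n, a - b * q ^+ n != 0) ->
    symmetrical u -> moment (sigma u) 0 != 0 ->
    (forall n, (q ^+ n - a) * moment (sigma u) n.+1
               = (q ^+ n - b) * moment (sigma u) n) ->
  regular u.
Proof.
move=> q0 q_nroot qa qb ab u_sym u0 u_rec.
have mom_neq0 n : moment (sigma u) n != 0.
  elim: n => [//|n IHn]; apply: contra_neq (mulf_neq0 (qb n) IHn) => mom0.
  by rewrite -u_rec mom0 mulr0.
have test n i k : sigma u ('X^(i + k) * littleqJ q a b n i)
    = moment (sigma u) (i + k) * littleqJ_ratio q a b n i k.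
  exact: (littleqJ_moment qa u_rec).
apply: (regular_of_even_odd u_sym (P0 := littleqJ q a b ^~ 0%N)
  (P1 := littleqJ q a b ^~ 1%N)) => [n|n|n k|n k|n|n]; rewrite ?size_littleqJ //.
- by move=> lt_kn; rewrite -[k]add0n test littleqJ_ratio_eq0 ?mulr0.
- by move=> lt_kn; rewrite -add1n test littleqJ_ratio_eq0 ?mulr0.
- by rewrite -[X in 'X^X]add0n test mulf_neq0 ?littleqJ_ratio_diag_neq0.
by rewrite -add1n test mulf_neq0 ?littleqJ_ratio_diag_neq0.
Qed.

(** * Functional equation and class *)

Lemma fsprod_gt0 (F : numDomainType) (T : choiceType) (D : set T) (f : T -> F) :
  (forall x, D x -> 0 < f x) -> 0 < \big[*%R/1]_(x \in D) f x.
Proof.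
move=> f_gt0; case: finite_supportP => [_|X XD _ _]; first by rewrite big_nil.
by rewrite big_seq prodr_gt0 // => x /XD; exact: f_gt0.
Qed.

Lemma theta_eq (R : realType) (c : R[i]) (f g : {poly R[i]}) :
  f - f.[c]%:P = g * ('X - c%:P) -> theta c f = g.
Proof. by rewrite /theta => ->; rewrite mulpK ?polyXsubC_eq0. Qed.

Lemma Hpoly_cubic (R : realType) (r : R[i]) : r != 1 ->
  Hpoly r ('X * ('X^2 - 1)) = (1 + r + r ^+ 2) *: 'X^2 - 1.
Proof.
move=> r1; have r1' : r - 1 != 0 by rewrite subr_eq0.
have -> : 'X * ('X^2 - 1) = (-1) *: 'X^1 + 'X^3 :> {poly R[i]}.
  by rewrite scaleN1r expr1; ring.
rewrite Hpoly_linear !HpolyXn //= scaleN1r addrC expr0 alg_polyC.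
have -> : qnum r 1 = 1 by rewrite /qnum expr1 divff.
by congr (_ *: _ - _); rewrite /qnum; field.
Qed.

Section SymmetrizedForm.

Variables (R : realType) (r A B : R[i]) (u : form R).
Hypotheses (r_neq1 : r != 1) (u_sym : symmetrical u).

Let Phi : {poly R[i]} := 'X * ('X^2 - 1).
Let Psi : {poly R[i]} := (r + 1) *: (A *: 'X^2 - B%:P).

(** Tested on x^n the equation reads
    [n]_r (u_(n+2) - u_n) + (r + 1)(A u_(n+2) - B u_n) = 0.  Every moment in it
    is zero for n odd, and [2k]_r = (r + 1) [k]_(r^2). *)
Lemma symmetrized_equation :
    r + 1 != 0 ->
    (forall n, (A + qnum (r ^+ 2) n) * moment (sigma u) n.+1
               = (B + qnum (r ^+ 2) n) * moment (sigma u) n) ->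
  Hform r (mulform Phi u) \- mulform Psi u =1 \0.
Proof.
move=> r1 u_rec; pose D : form R := Hform r (mulform Phi u) \- mulform Psi u.
suff D0 : D =1 (\0 : form R) by exact: D0.
have uZ c f : u (c *: f) = c * u f by rewrite linearZ.
have uB f g : u (f - g) = u f - u g by rewrite linearB.
have momS n : moment (sigma u) n = moment u n.*2.
  by rewrite /moment /sigma /= /sigma_fun comp_Xn_poly -exprM mul2n.
apply: formP => n.
have -> : moment (\0 : form R) n = 0 by [].
have -> : moment D n = - u (Phi * Hpoly r 'X^n) - u (Psi * 'X^n) by [].
have -> : Phi * Hpoly r 'X^n = qnum r n *: ('X^(n.+2) - 'X^n).
  rewrite HpolyXn // -scalerAr; case: n => [|n] /=.
    by rewrite /qnum expr0 subrr mul0r !scale0r.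
  by rewrite /Phi mulrAC -exprS mulrBr mulr1 -exprD addn2.
have -> : Psi * 'X^n = (r + 1) *: (A *: 'X^(n.+2) - B *: 'X^n).
  by rewrite -scalerAl mulrBl -scalerAl -exprD mul_polyC.
rewrite !uZ !uB !uZ -![u 'X^_]/(moment u _).
have [n_odd|n_even] := boolP (odd n).
  have odd0 m : odd m -> moment u m = 0.
    by move=> m_odd; rewrite -[m]odd_double_half m_odd; exact: u_sym.
  by rewrite !odd0 ?oddS ?negbK // !(subr0, mulr0, oppr0).
have {n_even} [k ->] : exists k, n = k.*2 by exists n./2; rewrite even_halfK.
have := u_rec k; rewrite !momS doubleS => u_rec_k.
have -> : qnum r k.*2 = (r + 1) * qnum (r ^+ 2) k.
  rewrite /qnum -mul2n exprM (_ : r ^+ 2 - 1 = (r - 1) * (r + 1)); last by ring.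
  by field; rewrite subr_eq0 r_neq1 r1.
rewrite [LHS](_ : _ = - (r + 1) * ((A + qnum (r ^+ 2) k) * moment u k.*2.+2
  - (B + qnum (r ^+ 2) k) * moment u k.*2)); last by ring.
by rewrite u_rec_k subrr mulr0.
Qed.

(** At c = 0 the first term is r (r + 1) B - 1.  At c = 1 and c = -1 the two
    terms are r (r + 1)(1 - A r^2 + B) and c (r + 1)(1 - A r^2), which both
    vanish only if B = 0. *)
Lemma symmetrized_class :
    r != 0 -> r + 1 != 0 -> B != 0 -> r * (r + 1) * B != 1 ->
    moment u 0 = 1 ->
  class_condition r u Phi (- Psi).
Proof.
move=> r0 r1 B0 rB u0; apply: fsprod_gt0 => c /= root_c.
have u1 : u 1 = 1 by rewrite -[RHS]u0 /moment expr0.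
have uX : u 'X = 0 by exact: (u_sym 0).
have uZ d f : u (d *: f) = d * u f by rewrite linearZ.
have uD f g : u (f + g) = u f + u g by rewrite linearD.
have uC d : u d%:P = d by rewrite -alg_polyC uZ u1 mulr1.
have PsiE z : (- Psi).[z] = - ((r + 1) * (A * z ^+ 2 - B)).
  by rewrite /Psi !hornerE.
have HE z : (Hpoly r Phi).[z] = (1 + r + r ^+ 2) * z ^+ 2 - 1.
  by rewrite Hpoly_cubic // !hornerE.
rewrite lt_neqAle addr_ge0 // andbT eq_sym paddr_eq0 // !normr_eq0 PsiE HE.
apply/negP => /andP[/eqP E1 /eqP E2].
have [c0|c0] := eqVneq c 0.
  by case/eqP: rB; apply/eqP; rewrite -subr_eq0 -E1 c0; apply/eqP; ring.
have cc : c ^+ 2 = 1.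
  move: root_c; rewrite /root /Phi !hornerE mulf_eq0 (negPf c0) subr_eq0.
  by move/eqP.
have thPsi : theta (c * r) (- Psi) = (- ((r + 1) * A)) *: ('X + (c * r)%:P).
  apply: theta_eq; rewrite PsiE /Psi -!mul_polyC !(rmorphM, rmorphB, rmorphN, rmorphXn) /=.
  by rewrite rmorphD; ring.
have thPhi : theta c Phi = 'X * ('X + c%:P).
  apply: theta_eq; rewrite (eqP root_c) /Phi subr0 -[1]/(1%:P) -cc rmorphXn /=; ring.
have thth : theta (c * r) ('X * ('X + c%:P)) = 'X + (c * r + c)%:P.
  by apply: theta_eq; rewrite !hornerE !(rmorphD, rmorphM) /=; ring.
move: E1 E2; rewrite thPsi thPhi thth !uD !uZ !uD !uX !uC !add0r => E1 E2.
have E2' : c * (r + 1) * (1 - A * r ^+ 2) = 0 by rewrite -[RHS]E2; ring.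
have E1' : r * (r + 1) * (1 - A * r ^+ 2 + B) = 0.
  by rewrite -[RHS]E1 exprMn cc; ring.
move/eqP: E2'; rewrite !mulf_eq0 (negPf c0) (negPf r1) /= => /eqP Ar.
by move/eqP: E1'; rewrite !mulf_eq0 (negPf r0) (negPf r1) Ar add0r (negPf B0).
Qed.

End SymmetrizedForm.

(** * The symmetrized q-Jacobi form *)

Theorem mainTheorem6 (R : realType) (q al be : R[i]) (hq : Ctilde q)
    (h1 : al + be != (3 - 2 * q) / (q - 1))
    (h2 : be != (sqrtc q * (sqrtc q + 1))^-1 - 1)
    (h3 : forall n : nat, al + be != - qnum q n - 2)
    (h4 : forall n : nat, be != - qnum q n - 1)
    (h5 : forall n : nat, al + be + 2 - (be + 1) * q ^+ n + qnum q n != 0) :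
  semiclassical_of_class (sqrtc q) (qJacobi_sym al be q) 1 /\
  Hform (sqrtc q) (mulform ('X * ('X^2 - 1)) (qJacobi_sym al be q))
    \- mulform ((sqrtc q + 1) *: ((al + be + 2) *: 'X^2 - (be + 1)%:P))
         (qJacobi_sym al be q) =1 \0.
Proof.
have [q0 q_nroot] := hq.
have q1 : q != 1 by have := q_nroot 1%N isT; rewrite expr1.
have q1' : q - 1 != 0 by rewrite subr_eq0.
have [/(is_qJacobiE _ _ _ q1)[J0 J_rec] _] := qJacobiP q1 h3.
have [[G_sym GJ] _] := qJacobi_symP al be q.
set G := qJacobi_sym al be q in G_sym GJ *.
have momJ n : moment (sigma G) n = moment (qJacobi al be q) n by exact: GJ.
have G0 : moment G 0 = 1.
  rewrite -J0 -momJ /moment /sigma /= /sigma_fun comp_Xn_poly.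
  by rewrite -exprM muln0.
have G_rec n : (al + be + 2 + qnum q n) * moment (sigma G) n.+1
             = (be + 1 + qnum q n) * moment (sigma G) n.
  by rewrite !momJ J_rec.
(* a and b are 1 - (q - 1) x for x = al + be + 2 and x = be + 1. *)
have qn_shift n x : q ^+ n - (1 - (q - 1) * x) = (q - 1) * (x + qnum q n).
  by rewrite /qnum; field.
have G_reg : regular G.
  apply: (@regular_of_qJacobi_moments _ q (1 - (q - 1) * (al + be + 2))
    (1 - (q - 1) * (be + 1))) => // [n|n|n||n].
  - rewrite qn_shift mulf_neq0 // -addrA addr_eq0 opprD [- 2 - _]addrC.
    exact: h3.
  - rewrite qn_shift mulf_neq0 // -addrA addr_eq0 opprD [- 1 - _]addrC.
    exact: h4.
  - rewrite [X in X != 0](_ : _ = - (q - 1) *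
      (al + be + 2 - (be + 1) * q ^+ n + qnum q n)).
      by rewrite mulf_neq0 ?oppr_eq0.
    by rewrite /qnum; field.
  - by rewrite momJ J0 oner_neq0.
  by rewrite !qn_shift -!mulrA G_rec.
have qE : sqrtc q ^+ 2 = q by rewrite sqr_sqrtc.
move: h2; set r := sqrtc q in qE *; rewrite -qE in q0 q1 G_rec h3 h4 => h2'.
have r0 : r != 0 by move: q0; rewrite expf_eq0.
have r_neq1 : r != 1 by apply: contra_neq q1 => ->; rewrite expr1n.
have r1 : r + 1 != 0.
  by apply: contra_neq q1 => /eqP; rewrite addr_eq0 => /eqP ->; rewrite sqrrN expr1n.
have qnum0 x : qnum x 0 = 0 by rewrite /qnum expr0 subrr mul0r.
have A0 : al + be + 2 != 0.
  by have := h3 0%N; rewrite qnum0 oppr0 sub0r addr_eq0.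
have B0 : be + 1 != 0 by have := h4 0%N; rewrite qnum0 oppr0 sub0r addr_eq0.
have G_eq := symmetrized_equation r_neq1 G_sym r1 G_rec.
split=> //.
exists ('X * ('X^2 - 1)), (- ((r + 1) *: ((al + be + 2) *: 'X^2 - (be + 1)%:P))).
have szQ : size ((al + be + 2) *: 'X^2 - (be + 1)%:P : {poly R[i]}) = 3.
  rewrite size_polyDl size_scale // size_polyXn // size_polyN.
  by apply: leq_ltn_trans (size_polyC_leq1 _) _.
have szQ1 : size ('X^2 - 1 : {poly R[i]}) = 3 by rewrite size_XnsubC.
split.
- split=> //.
  + by rewrite monicMl ?monicX // monicXnsubC.
  + by rewrite size_polyN size_scale // szQ.
  by move=> f; have := G_eq f; rewrite /mulform /= /mul_fun mulNr linearN.
- rewrite size_polyN size_scale // szQ mulrC size_mulX ?szQ1 //.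
  by rewrite -size_poly_eq0 szQ1.
apply: symmetrized_class => //; apply: contra_neq h2' => rB.
rewrite -[LHS](addrK 1); congr (_ - 1).
by apply: (mulfI (mulf_neq0 r0 r1)); rewrite rB mulfV ?mulf_neq0.
Qed.
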